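(* Let $m$ be a natural number ($m\ge1$) and let $p\in\{0,\dots,2m-1\}$. Then $$B_p=\sum_{j=1}^m\gamma_{m,j}\sum_{i=0}^{j-1}\Big(\frac j2-i-1\Big)^p=\frac1{2^p}\Big(\tau_{m,1}(-1)^p+\sum_{\beta=2}^m\tau_{m,\beta}\big[(\beta-2)^p+(-\beta)^p\big]\Big),$$ where $B_p$ is the $p$th Bernoulli number.
   Context: Bernoulli numbers: $B_0=1$, $B_1=-1/2$, and $B_j=B_j(0)$ for $j\ge2$, where the Bernoulli polynomials are defined by $B_0(x)=1$, $B_j'(x)=jB_{j-1}(x)$, $\int_0^1B_j(x)\,dx=0$ for $j\ge1$. Coefficients: $\gamma_{m,j}:=(-1)^{j-1}\,\frac2j\,\binom{2m}{m+j}\big/\binom{2m}{m}$ for $j\ge1$, and $\tau_{m,r}:=\sum_{\beta=0}^{\lfloor m/2-r/2\rfloor}\gamma_{m,r+2\beta}$ for $r\ge1$. Conventions: $0^0:=1$, and the sum of an empty family is $0$. *)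

(* Defs.v *)
From HB Require Import structures.
From mathcomp Require Import all_boot all_order all_algebra.
From mathcomp Require Import all_classical all_reals all_analysis.

Set Implicit Arguments.
Unset Strict Implicit.
Unset Printing Implicit Defensive.

Import Order.TTheory GRing.Theory Num.Theory.
Import numFieldNormedType.Exports.
Local Open Scope ring_scope.

Definition poly_primitive (F : fieldType) (q : {poly F}) : {poly F} :=
  \poly_(i < (size q).+1) (if i is k.+1 then q`_k / k.+1%:R else 0).

Definition int01 (R : realType) (q : {poly R}) : R :=
  \int[lebesgue_measure]_(x in `[0%R, 1%R]%classic) q.[x].

(* The unique sequence with B_0 = 1, B_j' = j B_{j-1} and \int_0^1 B_j = 0 for
   1 <= j: see bernoulli_polyP and bernoulli_poly_unique below. *)
Fixpoint bernoulli_poly (R : realType) (j : nat) : {poly R} :=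
  if j is k.+1 then
    let q := poly_primitive (j%:R *: bernoulli_poly R k) in q - (int01 q)%:P
  else 1.

Definition bernoulli_number (R : realType) (j : nat) : R :=
  match j with
  | 0 => 1
  | 1 => - (1 / 2)
  | _ => (bernoulli_poly R j).[0]
  end.

Definition gamma_coef (R : realType) (m j : nat) : R :=
  (-1) ^+ (j - 1) * (2 / j%:R) * ('C(2 * m, m + j)%:R / 'C(2 * m, m)%:R).

(* The index b ranges over 0 <= b <= floor (m/2 - r/2).  The number of such b is
   (m + 2 - r)./2, which is 0 when m < r, i.e. when that floor is negative. *)
Definition tau_coef (R : realType) (m r : nat) : R :=
  \sum_(0 <= b < (m + 2 - r)./2) gamma_coef R m (r + 2 * b).

Definition is_bernoulli_poly_seq (R : realType) (B : nat -> {poly R}) : Prop :=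
  B 0 = 1 /\
  forall j : nat, (1 <= j)%N ->
    (B j)^`() = j%:R *: B j.-1 /\
    \int[lebesgue_measure]_(x in `[0%R, 1%R]%classic) (B j).[x] = 0.

Lemma deriv_poly_primitive (R : realType) (q : {poly R}) :
  (poly_primitive q)^`() = q.
Proof.
apply/polyP => i; rewrite coef_deriv coef_poly ltnS.
case: ltnP => hi; last by rewrite mul0rn nth_default.
by rewrite -[LHS]mulr_natr divfK // pnatr_eq0.
Qed.

Lemma int01BC (R : realType) (q : {poly R}) (c : R) :
  int01 (q - c%:P) = int01 q - c.
Proof.
have iq (p : {poly R}) :
    lebesgue_measure.-integrable `[0%R, 1%R]%classic (EFin \o horner p).
  apply: continuous_compact_integrable; first exact: segment_compact.
  by apply: continuous_subspaceT; exact: continuous_horner.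
rewrite /int01.
under eq_Rintegral do rewrite hornerD hornerN.
rewrite RintegralB //.
under [X in _ - X]eq_Rintegral do rewrite hornerC.
rewrite Rintegral_cst // [fine _](_ : _ = 1) ?mulr1 //.
by rewrite /= lebesgue_measure_itv /= lte_fin ltr01 /= oppr0 addr0.
Qed.

Lemma bernoulli_polyP (R : realType) : is_bernoulli_poly_seq (bernoulli_poly R).
Proof.
split=> // -[//|j] _; split.
  by rewrite /= derivB derivC subr0 deriv_poly_primitive.
by rewrite -/(int01 _) /= int01BC subrr.
Qed.

Lemma bernoulli_poly_unique (R : realType) (B : nat -> {poly R}) :
  is_bernoulli_poly_seq B -> B =1 bernoulli_poly R.
Proof.
have [_ HB'] := bernoulli_polyP R.
case=> [B0 HB]; elim=> [|j IH]; first by rewrite B0.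
have [dB iB] := HB j.+1 isT; have [dB' iB'] := HB' j.+1 isT.
set b := bernoulli_poly R j.+1 in dB' iB' *.
have dD : (B j.+1 - b)^`() = 0 by rewrite derivB dB dB' /= IH subrr.
have cD : B j.+1 = b - (- (B j.+1 - b)`_0)%:P.
  apply/eqP; rewrite polyCN opprK addrC -subr_eq; apply/eqP/polyP=> -[|i].
    by rewrite coefC.
  rewrite [RHS]coefC /=; move/polyP/(_ i): dD.
  by rewrite coef_deriv coef0 => /eqP; rewrite mulrn_eq0 /= => /eqP.
move: iB; rewrite -/(int01 _) cD int01BC [int01 b]iB' sub0r opprK => c0.
by rewrite c0 oppr0 subr0.
Qed.

(* Main.v *)
(* Let L(q) be the sum over j of gamma_j times the sum of q (j/2 - i - 1) for
   0 <= i < j.  On a difference q (x + 1) - q (x) the inner sums telescope, and L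
   becomes the sum of gamma_j (q (j/2) - q (- j/2)), which is the central
   difference formula for q' (0), exact up to degree 2m.  Hence the polynomials
   b_p (y) = L_x ((x + y) ^ p) satisfy b_p' = p b_{p-1} and have integral
   [p = 0] over [0, 1] for p < 2m, so that b_p is the p-th Bernoulli polynomial.
   The second equality exchanges the sums after grouping the nodes j - 2i - 2
   into the pairs {r - 2, - r} with r of the same parity as j. *)
Require Import Defs.
From HB Require Import structures.
From mathcomp Require Import all_boot all_order all_algebra.
From mathcomp Require Import all_classical all_reals all_analysis.
From mathcomp Require Import ring lra zify.

Import Order.TTheory GRing.Theory Num.Theory.
Local Open Scope ring_scope.

(** Pascal's rule and a shift of index turn the difference of order [n.+1] of [f] into that of order
    [n] of its first differences. *)
Lemma alternating_binomial_sum_recl (V : comPzRingType) (n : nat) (f : nat -> V) :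
  \sum_(0 <= i < n.+2) (-1) ^+ i * 'C(n.+1, i)%:R * f i =
  \sum_(0 <= i < n.+1) (-1) ^+ i * 'C(n, i)%:R * (f i - f i.+1).
Proof.
rewrite big_nat_recl // bin0.
under eq_bigr do rewrite binS natrD exprS mulrDr mulrDl.
rewrite big_split /= big_nat_recr //= (@bin_small n n.+1) //.
rewrite mulr0 mul0r addr0.
under [RHS]eq_bigr do rewrite mulrBr.
rewrite sumrB [X in _ = X - _]big_nat_recl // bin0 -addrA; congr (_ + (_ + _)).
  by apply: eq_bigr => i _; rewrite exprS.
by rewrite -sumrN; apply: eq_bigr => i _; ring.
Qed.

(** Each first difference lowers the degree, so that differences of order [n] annihilate powers
    below [n]. *)
Lemma alternating_binomial_sum_pow (V : comPzRingType) (n e : nat) (a : V) :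
  (e < n)%N ->
  \sum_(0 <= i < n.+1) (-1) ^+ i * 'C(n, i)%:R * (a + i%:R) ^+ e = 0.
Proof.
elim: n e => [//|n IH] e le_en.
rewrite (alternating_binomial_sum_recl V n (fun i => (a + i%:R) ^+ e)).
have diffE (x : V) : x ^+ e - (x + 1) ^+ e = - \sum_(k < e) x ^+ k *+ 'C(e, k).
  by rewrite exprD1n big_ord_recr /= binn mulr1n opprD addrCA addrN addr0.
under eq_bigr => i _.
  rewrite -natr1 addrA diffE mulrN mulr_sumr -sumrN.
  over.
rewrite exchange_big /= big1 // => k _.
under eq_bigr do rewrite [_ * (_ *+ 'C(e, k))]mulrnAr.
by rewrite sumrN sumrMnl IH ?mul0rn ?oppr0 // (leq_trans (ltn_ord k)).
Qed.

Lemma sum_nat_symm (V : nmodType) (m : nat) (F : nat -> V) :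
  \sum_(0 <= i < (2 * m).+1) F i =
  F m + \sum_(1 <= j < m.+1) (F (m + j)%N + F (m - j)%N).
Proof.
rewrite (@big_cat_nat _ _ _ m) //=; last by lia.
rewrite [X in _ + X]big_ltn; last by lia.
rewrite addrCA; congr (_ + _).
rewrite big_split addrC /=; congr (_ + _).
  rewrite -[m.+1]addn1 addnC big_addn (_ : (2 * m).+1 - m = m.+1)%N; last by lia.
  by apply: eq_bigr => i _; rewrite addnC.
rewrite big_nat_rev /= [RHS]big_add1 /=.
by apply: eq_big_nat => i _; rewrite add0n.
Qed.

Section BernoulliQuadrature.
Variable R : realType.
Implicit Types m p : nat.

(* On monomials: the central difference formula with step 1/2 for the derivative
   at 0 is exact up to degree [2 * m].  Up to a constant factor, adding the
   missing term [j = 0] turns the left-hand side into the finite difference of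
   order [2 * m] of [x ^+ p], which vanishes. *)
Lemma central_difference_pow m p : (p < 2 * m)%N ->
  \sum_(1 <= j < m.+1) gamma_coef R m j *
     ((j%:R / 2) ^+ p.+1 - (- (j%:R / 2)) ^+ p.+1) = (p == 0%N)%:R.
Proof.
move=> lt_pm.
have C0 : 'C(2 * m, m)%:R != 0 :> R by rewrite pnatr_eq0 -lt0n bin_gt0; lia.
have mm : (-1) ^+ m * (-1) ^+ m = 1 :> R.
  by rewrite -expr2 -exprM mulnC exprM sqrrN !expr1n.
have := @alternating_binomial_sum_pow R (2 * m) p (- m%:R) lt_pm.
rewrite sum_nat_symm addNr expr0n => /eqP; rewrite addrC addr_eq0 => /eqP S.
(* The first factor relates the [j]-th terms of the two sums; the second is the value given by
   [S]. *)
have -> : (p == 0%N)%:R = - ((-1) ^+ m / 'C(2 * m, m)%:R / 2 ^+ p) *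
   - ((-1) ^+ m * 'C(2 * m, m)%:R * (p == 0%N)%:R) :> R.
  rewrite mulrNN; case: eqP => [->|_]; last by rewrite !mulr0.
  by rewrite expr0 /= mulr1n -[LHS]mm; field.
rewrite -S mulr_sumr; apply: eq_big_nat => j /andP[j1 jm].
have [k jE] : exists k, j = k.+1 by exists j.-1; lia.
have -> : 'C(2 * m, m - j) = 'C(2 * m, m + j).
  by rewrite -bin_sub; [congr binomial; lia | lia].
have -> : - m%:R + (m + j)%:R = j%:R :> R by rewrite natrD; ring.
have -> : - m%:R + (m - j)%:R = - j%:R :> R by rewrite natrB; [ring | lia].
have -> : (-1) ^+ (m - j) = (-1) ^+ (m + j) :> R.
  by rewrite -signr_odd -[RHS]signr_odd; congr (_ ^+ _); congr nat_of_bool; lia.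
rewrite /gamma_coef jE subn1 /= !exprS exprD.
rewrite -!mulNr !exprMn exprVn (exprNn k.+1%:R) exprS.
have kn : k.+1%:R != 0 :> R by rewrite pnatr_eq0.
have p2 : 2 ^+ p != 0 :> R by rewrite expf_neq0 // pnatr_eq0.
move: mm kn p2 C0; move: (k.+1%:R : R) ('C(2 * m, m + k.+1)%:R : R).
move: ('C(2 * m, m)%:R : R) ((-1) ^+ m : R) ((-1) ^+ k : R).
move: ((-1) ^+ p : R) (2 ^+ p : R) => e t c a s x b aa x0 t0 c0.
move: (x ^+ p) => y.
(* [field] does not know that [(-1) ^+ m] squares to 1: the square is exposed as [a * a], then
   removed by [aa]. *)
transitivity (a * a * s * (b / c) * y * (1 + e) / t); last first.
  by field; rewrite t0.
by rewrite aa; field; rewrite t0 c0.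
Qed.

Import numFieldNormedType.Exports.

Lemma int01_deriv (q : {poly R}) : int01 q^`() = q.[1] - q.[0].
Proof.
rewrite /int01 /Rintegral.
rewrite (@continuous_FTC2 R (horner q^`()) (horner q) 0 1) //=.
- by apply: continuous_subspaceT; exact: continuous_horner.
- split=> [x _||].
  + exact: derivable_horner.
  + by apply: cvg_at_right_filter; exact: continuous_horner.
  + by apply: cvg_at_left_filter; exact: continuous_horner.
- by move=> x _; rewrite derivE.
Qed.

(** Equal derivatives leave a constant difference, and the integral determines it. *)
Lemma eq_poly_deriv_int01 (q r : {poly R}) :
  q^`() = r^`() -> int01 q = int01 r -> q = r.
Proof.
move=> dE iE.
have cE : q = r - (- (q - r)`_0)%:P.
  apply/eqP; rewrite polyCN opprK addrC -subr_eq; apply/eqP/polyP=> -[|i].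
    by rewrite coefC.
  have /polyP/(_ i) : (q - r)^`() = 0 by rewrite derivB dE subrr.
  by rewrite [RHS]coefC coef_deriv coefC if_same => /eqP; rewrite mulrn_eq0 => /eqP.
move: iE; rewrite cE int01BC => /eqP.
by rewrite opprK addrC -subr_eq0 addrK => /eqP ->; rewrite oppr0 subr0.
Qed.

(** The functional L applied in x to (x + y) ^ p, with ['X] standing for y; its value at 0 is the
    double sum of the theorem. *)
Definition quadrature_poly m p : {poly R} :=
  \sum_(1 <= j < m.+1) gamma_coef R m j *:
    \sum_(0 <= i < j) ('X + (j%:R / 2 - i%:R - 1)%:P) ^+ p.

Lemma deriv_quadrature_poly m p :
  (quadrature_poly m p)^`() = p%:R *: quadrature_poly m p.-1.
Proof.
rewrite /quadrature_poly raddf_sum scaler_sumr; apply: eq_bigr => j _.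
rewrite /= derivZ [RHS]scalerA [p%:R * _]mulrC -[RHS]scalerA; congr (_ *: _).
rewrite raddf_sum scaler_sumr; apply: eq_bigr => i _.
by rewrite /= deriv_exp derivD derivX derivC addr0 mul1r scaler_nat.
Qed.

Lemma int01_quadrature_poly m p : (p < 2 * m)%N ->
  int01 (quadrature_poly m p) = (p == 0%N)%:R.
Proof.
move=> lt_pm.
have pn : p.+1%:R != 0 :> R by rewrite pnatr_eq0.
(* With the integrand written as a derivative, only an increment from 0 to 1 remains. *)
have -> : quadrature_poly m p = (p.+1%:R^-1 *: quadrature_poly m p.+1)^`().
  by rewrite derivZ deriv_quadrature_poly scalerA mulVf // scale1r.
rewrite int01_deriv !hornerZ -mulrBr /quadrature_poly !horner_sum -sumrB.
rewrite (_ : (p == 0%N)%:R = p.+1%:R^-1 * (p == 0%N)%:R :> R); last first.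
  by case: eqP => [->|_]; rewrite ?invr1 ?mulr1 ?mulr0.
congr (_ * _); rewrite -(@central_difference_pow m p lt_pm).
apply: eq_bigr => j _; rewrite !hornerZ -mulrBr; congr (_ * _).
rewrite !horner_sum -sumrB -[LHS]opprK -sumrN.
(* Adding 1 moves each node to the preceding one; only the ends [j / 2] and [- j / 2] survive. *)
rewrite (@telescope_sumr_eq _ 0 j (fun i => (j%:R / 2 - i%:R) ^+ p.+1)) //.
  by rewrite opprB subr0; congr (_ - _ ^+ _); field.
move=> i _; rewrite !horner_exp !hornerD !hornerX !hornerC opprB add0r.
by congr (_ ^+ _ - _ ^+ _); rewrite -?natr1; ring.
Qed.

Lemma quadrature_polyE m p :
  (p < 2 * m)%N -> quadrature_poly m p = bernoulli_poly R p.
Proof.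
have [_ HB] := bernoulli_polyP R.
elim: p => [|p IH] lt_pm.
  apply: eq_poly_deriv_int01.
    by rewrite deriv_quadrature_poly scale0r /= derivC.
  rewrite int01_quadrature_poly //=.
  have -> : 1 = ('X : {poly R})^`() by rewrite derivX.
  by rewrite int01_deriv !hornerX subr0.
have [dB iB] := HB p.+1 isT.
apply: eq_poly_deriv_int01.
  by rewrite deriv_quadrature_poly dB /= IH // ltnW.
by rewrite int01_quadrature_poly // [RHS]iB.
Qed.

Lemma horner_quadrature_poly0 m p :
  (quadrature_poly m p).[0] =
  \sum_(1 <= j < m.+1) gamma_coef R m j *
      \sum_(0 <= i < j) (j%:R / 2 - i%:R - 1) ^+ p.
Proof.
rewrite horner_sum; apply: eq_bigr => j _; rewrite hornerZ horner_sum.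
congr (_ * _); apply: eq_bigr => i _.
by rewrite horner_exp hornerD hornerX hornerC add0r.
Qed.

Lemma bernoulli_numberE p : bernoulli_number R p = (bernoulli_poly R p).[0].
Proof.
case: p => [|[|p]] //; first by rewrite /= hornerC.
(* Only [p = 1], fixed by convention, remains: for [m = 1] there is a single node - 1/2, of weight
   1. *)
rewrite -(@quadrature_polyE 1) // horner_quadrature_poly0 !big_nat1.
by rewrite /gamma_coef subnn bin1 binn expr0 expr1 /=; field.
Qed.

End BernoulliQuadrature.

(** Raising [m] adds a term exactly when [m.+1] is at least [r] and of its parity. The filtered form
    allows the sums over [r] and [j] to be exchanged. *)
Lemma sum_parity_step (V : nmodType) (m r : nat) (g : nat -> V) : (0 < r)%N ->
  \sum_(0 <= b < (m + 2 - r)./2) g (r + 2 * b)%N =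
  \sum_(1 <= j < m.+1 | (r <= j)%N && (odd r == odd j)) g j.
Proof.
move=> r0; elim: m => [|m IH].
  by rewrite big_geq; [rewrite big_geq | lia].
rewrite [RHS]big_mkcond big_nat_recr //= -big_mkcond /= -IH.
case: ifP => [/andP[rm /eqP om]|/negbT h].
  rewrite (_ : (m.+1 + 2 - r)./2 = (m + 2 - r)./2.+1)%N; last by lia.
  by rewrite big_nat_recr //=; congr (_ + g _); lia.
by rewrite addr0 (_ : (m.+1 + 2 - r)./2 = (m + 2 - r)./2)%N //; lia.
Qed.

(* Each passage from [j] to [j.+2] adds the two endpoints [j] and [- j.+2] of the
   progression [j, j - 2, .., - j.+2], i.e. the term [r = j.+2] on the right. *)
Lemma sum_symm_progression (V : comPzRingType) (p j : nat) :
  \sum_(0 <= i < j) (j%:R - 2 * i%:R - 2) ^+ p =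
  \sum_(1 <= r < j.+1 | odd r == odd j)
     (if r == 1%N then (-1) ^+ p else (r%:R - 2) ^+ p + (- r%:R) ^+ p) :> V.
Proof.
have [n] := ubnP j; elim: n j => // n IH [|[|j]] lt_jn.
- by rewrite !big_geq.
(* For [r = 1] the nodes [r - 2] and [- r] are both - 1 and count once, whence the separate
   value. *)
- by rewrite big_nat1 big_mkcond big_nat1 /=; congr (_ ^+ _); ring.
rewrite big_nat_recl // big_nat_recr //= [RHS]big_mkcond.
rewrite [RHS]big_nat_recr // [X in _ = X + _]big_nat_recr //=.
rewrite negbK eqxx -big_mkcond /=.
rewrite (_ : (~~ odd j == odd j) = false); last by case: odd.
rewrite addr0 -IH; last by lia.
rewrite addrCA; congr (_ + (_ + _)).
- by apply: eq_bigr => i _; congr (_ ^+ _); rewrite -!natr1; ring.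
- by congr (_ ^+ _); rewrite -!natr1; ring.
- by congr (_ ^+ _); rewrite -!natr1; ring.
Qed.

Theorem proposition3p6 (R : realType) (m p : nat)
    (hm : (1 <= m)%N) (hp : (p <= 2 * m - 1)%N) :
  bernoulli_number R p =
    \sum_(1 <= j < m.+1) gamma_coef R m j *
      \sum_(0 <= i < j) (j%:R / 2 - i%:R - 1) ^+ p
  /\
  \sum_(1 <= j < m.+1) gamma_coef R m j *
      \sum_(0 <= i < j) (j%:R / 2 - i%:R - 1) ^+ p =
    1 / 2 ^+ p *
      (tau_coef R m 1 * (-1) ^+ p +
       \sum_(2 <= b < m.+1)
          tau_coef R m b * ((b%:R - 2) ^+ p + (- b%:R) ^+ p)).
Proof.
split.
  by rewrite bernoulli_numberE -(@quadrature_polyE R m) ?horner_quadrature_poly0 //; lia.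
pose w (r : nat) : R :=
  if r == 1%N then (-1) ^+ p else (r%:R - 2) ^+ p + (- r%:R) ^+ p.
have -> : tau_coef R m 1 * (-1) ^+ p +
    \sum_(2 <= b < m.+1) tau_coef R m b * ((b%:R - 2) ^+ p + (- b%:R) ^+ p) =
    \sum_(1 <= r < m.+1) tau_coef R m r * w r.
  rewrite [RHS]big_ltn //; congr (_ + _); apply: eq_big_nat => r /andP[r2 _].
  by rewrite /w; case: eqP => // r1; move: r2; rewrite r1.
under [in RHS]eq_big_nat => r /andP[r0 _].
  rewrite /tau_coef sum_parity_step // big_mkcond mulr_suml.
  over.
rewrite exchange_big /= mulr_sumr; apply: eq_big_nat => j /andP[_ jm].
(* Doubling the nodes makes them integers and takes out the factor [1 / 2 ^+ p]. *)
rewrite (_ : \sum_(0 <= i < j) _ = 1 / 2 ^+ p * \sum_(1 <= r < j.+1 | odd r == odd j) w r).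
  rewrite mulrCA; congr (_ * _).
  (* The bound [r <= j] becomes a filter over the full range, as in the exchanged sum. *)
  rewrite (@big_nat_widen _ _ _ _ j.+1 m.+1) // big_mkcond mulr_sumr.
  by apply: eq_bigr => r _; rewrite andbC ltnS; case: ifP; rewrite ?mulr0 ?mul0r.
rewrite -sum_symm_progression mulr_sumr; apply: eq_bigr => i _.
by rewrite div1r -exprVn -exprMn; congr (_ ^+ _); field.
Qed.
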